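(* Every finite distributive lattice $L$ is isomorphic (as an ordered set) to the configuration space of some simple Edge Firing Game.
   Context: An Edge Firing Game (EFG) is given by a connected undirected graph $G=(V,E)$, a distinguished vertex $s\in V$ called the sink, and an orientation $G_0$ of $G$ (an orientation assigns to each edge $\{v,v'\}\in E$ exactly one of the directions $(v,v')$ or $(v',v)$). Configurations are orientations of $G$; $G_0$ is the initial configuration. Firing rule: if in configuration $C$ some vertex $\nu\neq s$ has only incoming edges (no outgoing edges), one may fire $\nu$, i.e. reverse all edges incident to $\nu$ (each $(v,\nu)$ becomes $(\nu,v)$), obtaining a new configuration $C'$. The configuration space is the set of configurations reachable from $G_0$ by sequences of firings, ordered by $C\ge C'$ iff some (possibly empty) sequence of firings transforms $C$ into $C'$. The EFG is called simple if, in any sequence of firings starting from the initial configuration, each vertex is fired at most once. *)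

(* Defs.v *)
From HB Require Import structures.
From mathcomp Require Import all_boot all_order.

Set Implicit Arguments.
Unset Strict Implicit.
Unset Printing Implicit Defensive.

Section Orientations.

Variables (V : finType) (e : rel V).
Implicit Types (C : {set V * V}) (u v : V) (vs : seq V).

(* An orientation of (V, e) is given by its set of arcs; (u, v) \in C means
   that the edge {u, v} is directed from u to v. *)
Definition is_orientation C : Prop :=
  (forall u v, (u, v) \in C -> e u v) /\
  (forall u v, e u v -> ((u, v) \in C) (+) ((v, u) \in C)).

Definition fire C v : {set V * V} :=
  [set a : V * V | if (a.1 == v) || (a.2 == v) then (a.2, a.1) \in C
                   else a \in C].

Variable s : V.

Definition can_fire C v : bool := (v != s) && [forall u, (v, u) \notin C].

Fixpoint firing_seq C vs : bool :=
  if vs is v :: vs' then can_fire C v && firing_seq (fire C v) vs' else true.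

Definition fires_to : rel {set V * V} :=
  [rel C C' | [exists v, can_fire C v && (C' == fire C v)]].

Lemma connect_fires_toP C C' :
  reflect (exists2 vs, firing_seq C vs & foldl fire C vs = C')
          (connect fires_to C C').
Proof.
apply: (iffP connectP) => [[p]|[vs]].
  elim: p C => [|D p IHp] C /=; first by move=> _ ->; exists [::].
  case/andP=> /existsP[v /andP[Cv /eqP->]] /IHp{}IHp /IHp[vs vsP <-].
  by exists (v :: vs); rewrite //= Cv.
elim: vs C => [|v vs IHvs] C /=; first by move=> _ <-; exists [::].
case/andP=> Cv /IHvs{}IHvs /IHvs[p pP ->].
exists (fire C v :: p) => //=; rewrite pP andbT.
by apply/existsP; exists v; rewrite Cv eqxx.
Qed.

Lemma fire_orientation C v :
  symmetric e -> is_orientation C -> is_orientation (fire C v).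
Proof.
move=> e_sym [Ce eC]; split=> x y; rewrite !inE /=.
  by case: ifP => _ /Ce //; rewrite e_sym.
by rewrite [(y == v) || _]orbC => /eC; case: ifP => // _; rewrite addbC.
Qed.

End Orientations.

Record edge_firing_game := EdgeFiringGame {
  vertex : finType;
  edge : rel vertex;
  edge_sym : symmetric edge;
  edge_irrefl : irreflexive edge;
  edge_connected : forall u v : vertex, connect edge u v;
  sink : vertex;
  init : {set vertex * vertex};
  init_orientation : is_orientation edge init
}.

Definition configuration_space (G : edge_firing_game) : finType :=
  {C : {set vertex G * vertex G} | connect (fires_to (sink G)) (init G) C}.

(* Firing goes downwards: the initial configuration is the greatest one. *)
Definition configuration_le (G : edge_firing_game)
    (C' C : configuration_space G) : bool :=
  connect (fires_to (sink G)) (val C) (val C').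

Definition simple_game (G : edge_firing_game) : Prop :=
  forall vs : seq (vertex G), firing_seq (sink G) (init G) vs -> uniq vs.

(* Main.v *)
(** The graph is the comparability graph of the poset V of join-prime elements
    of L, where \bot counts as join-prime and is the sink; initially every edge
    points upwards.  Since the sink is joined to every vertex and never fires, a
    vertex v fires at most once, and it may do so exactly when everything above
    v has fired.  So a configuration amounts to the upper set of V of the fired
    vertices, and by Birkhoff duality these sets are the sets
    [set v | ~~ (v <= x)] for x in L. *)
Require Import Defs.
From HB Require Import structures.
From mathcomp Require Import all_boot all_order.

Set Implicit Arguments.
Unset Strict Implicit.
Unset Printing Implicit Defensive.

Import Order.Theory.
Local Open Scope order_scope.

(** Take the element of [P] with the fewest elements strictly below it: passing to a smaller one
    would shrink that count. *)
Lemma exists_minimal (d : Order.disp_t) (T : finPOrderType d) (P : {pred T}) x :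
  x \in P -> exists2 m, m \in P & forall y, y < m -> y \notin P.
Proof.
move=> Px; case: (@arg_minnP _ x (mem P) (fun y => #|[pred z | z < y]|) Px).
move=> m Pm m_min; exists m => // y ym; apply/negP=> /m_min; rewrite leqNgt.
case/negP; apply/proper_card/properP; split.
  by apply/subsetP=> z /lt_trans; apply.
by exists y; rewrite !inE ?ltxx.
Qed.

(** * Configurations of the comparability game as upper sets *)

Section ComparabilityGame.

Variables (d : Order.disp_t) (V : finPOrderType d) (s : V).
Hypothesis s_min : forall v : V, s <= v.
Implicit Types (u v w : V) (F : {set V}).

Definition comparability : rel V := fun u v => (u < v) || (v < u).

Lemma comparability_sym : symmetric comparability.
Proof. by move=> u v; rewrite /comparability orbC. Qed.

Lemma comparability_irrefl : irreflexive comparability.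
Proof. by move=> u; rewrite /comparability ltxx. Qed.

Lemma lt_min v : (v < s) = false.
Proof. exact/le_gtF. Qed.

Lemma comparability_min v : comparability v s = (v != s).
Proof. by rewrite /comparability lt_min lt_def s_min andbT. Qed.

Lemma comparability_connected u v : connect comparability u v.
Proof.
have to_s w : connect comparability w s.
  case: (eqVneq w s) => [->|w_s]; first exact: connect0.
  by apply: connect1; rewrite comparability_min.
apply: connect_trans (to_s u) _.
by rewrite (sym_connect_sym comparability_sym).
Qed.

(* The configuration obtained from the upward orientation once exactly the
   vertices of F have fired, each of them once. *)
Definition fired_orientation F : {set V * V} :=
  [set a | comparability a.1 a.2 &&
           ((a.1 < a.2) (+) ((a.1 \in F) (+) (a.2 \in F)))].

(** These turn out to index exactly the reachable configurations. *)
Definition fired_set F : bool :=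
  (s \notin F) && [forall u in F, forall v, (u <= v) ==> (v \in F)].

Lemma fired_setP F :
  reflect (s \notin F /\ forall u v, u \in F -> u <= v -> v \in F)
          (fired_set F).
Proof.
apply: (iffP andP) => -[sF upF]; split=> //.
  by move=> u v uF; move/forall_inP: upF => /(_ u uF)/forallP/(_ v)/implyP.
by apply/forall_inP=> u uF; apply/forallP=> v; apply/implyP; apply: upF.
Qed.

Lemma fired_orientation_oriented F :
  is_orientation comparability (fired_orientation F).
Proof.
split=> u v; rewrite !inE /=; first by case/andP.
move=> uv; rewrite [comparability v u]comparability_sym uv /=.
rewrite [(v \in F) (+) _]addbC addbACA addbb addbF.
by case/orP: uv => lt; rewrite lt lt_gtF.
Qed.

(** The edges at the sink record [F], so [F] can be read back from its configuration. *)
Lemma mem_fired_orientation_min F v :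
  s \notin F -> ((v, s) \in fired_orientation F) = (v \in F).
Proof.
move=> sF; rewrite inE comparability_min lt_min (negPf sF) addbF /=.
by case: eqVneq => // ->; rewrite (negPf sF).
Qed.

(** Firing flips the parity of [v], which amounts to adding [v] to [F] only if it was absent. *)
Lemma fire_fired_orientation F v : v \notin F ->
  fire (fired_orientation F) v = fired_orientation (v |: F).
Proof.
move=> vF; apply/setP=> -[x y]; rewrite !inE /= /comparability.
case: (eqVneq x v) (eqVneq y v) => [->|xv] [->|yv] //=.
- by rewrite ltxx.
- rewrite (negPf vF) addbF.
  by case: (comparableP v y) yv => //= *; case: (y \in F).
- rewrite (negPf vF) addFb.
  by case: (comparableP x v) xv => //= *; case: (x \in F).
Qed.

(** For [v] to have no outgoing edge, the edge to the sink demands that [v] be unfired, and the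
    edges to larger vertices that these have fired. Smaller vertices impose nothing new: they are
    unfired because [F] is an upper set missing [v]. *)
Lemma can_fire_fired_orientation F v : fired_set F ->
  can_fire s (fired_orientation F) v = (v \notin F) && fired_set (v |: F).
Proof.
case/fired_setP=> sF upF; apply/andP/andP=> [[v_s /forallP arcs]|].
  have vF: v \notin F by rewrite -mem_fired_orientation_min.
  split=> //; apply/fired_setP; split; first by rewrite !inE eq_sym negb_or v_s.
  move=> u w; rewrite !inE => /predU1P[->|uF] uw; last first.
    by rewrite (upF u) ?orbT.
  case: eqVneq => //= w_v; have vw : v < w by rewrite lt_def w_v.
  by have := arcs w; rewrite inE /= /comparability vw (negPf vF) /= negbK.
case=> vF /fired_setP[]; rewrite !inE negb_or eq_sym => /andP[v_s _] upvF.
split=> //; apply/forallP=> u; rewrite inE /= /comparability (negPf vF) /=.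
case: (comparableP u v) => //= [uv|vu]; last first.
  have := upvF v u; rewrite !inE eqxx (ltW vu) => /(_ isT isT).
  by rewrite gt_eqF // => /= ->.
by apply: contra vF => uF; apply: upF (ltW uv).
Qed.

Lemma firing_seq_fired_orientation F vs :
    fired_set F -> firing_seq s (fired_orientation F) vs ->
  [/\ fired_set (F :|: [set:: vs]), uniq vs, {in vs, forall v, v \notin F} &
      foldl (@fire V) (fired_orientation F) vs
        = fired_orientation (F :|: [set:: vs])].
Proof.
elim: vs F => [|v vs IHvs] F FP /=.
  move=> _; rewrite (_ : F :|: _ = F) //.
  by apply/setP=> v; rewrite !inE orbF.
case/andP; rewrite can_fire_fired_orientation // => /andP[vF vFP].
rewrite fire_fired_orientation // => /IHvs-/(_ vFP)[].
have -> : v |: F :|: [set:: vs] = F :|: [set:: v :: vs].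
  by apply/setP=> u; rewrite !inE orbCA orbA.
move=> -> -> notF ->; split=> //.
  by rewrite andbT; apply/negP=> /notF; rewrite !inE eqxx.
by move=> u /predU1P[->//|/notF]; rewrite !inE negb_or => /andP[].
Qed.

Lemma connect_fired_orientation F F' : fired_set F -> fired_set F' ->
  connect (fires_to s) (fired_orientation F) (fired_orientation F')
    = (F \subset F').
Proof.
move=> FP; have [sF upF] := fired_setP _ FP => F'P.
apply/idP/idP => [/connect_fires_toP[vs] | ].
  have [s_F' _] := fired_setP _ F'P.
  case/(firing_seq_fired_orientation FP)=> /fired_setP[s_U _] _ _ -> eqU.
  apply/subsetP=> v vF; rewrite -mem_fired_orientation_min // -eqU.
  by rewrite mem_fired_orientation_min // inE vF.
have [n] := ubnP #|F' :\: F|; elim: n => // n IHn in F' F'P * => le_n FF'.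
have [/eqP|[v0 v0D]] := set_0Vmem (F' :\: F).
  by rewrite setD_eq0 => F'F; rewrite (eqP (_ : F == F')) // eqEsubset FF'.
(* This [v] is fired last. Removing it keeps [F'] an upper set: any [u < v] in [F'] would lie in [F]
   by minimality, forcing [v] into [F]. *)
have [v vD v_min] := exists_minimal v0D.
have [[vF' vF] [s_F' upF']] := (setDP vD, fired_setP _ F'P).
have D_v : F' :\ v :\: F = (F' :\: F) :\ v.
  by apply/setP=> u; rewrite !inE andbCA.
have F'vP : fired_set (F' :\ v).
  apply/fired_setP; split=> [|u w]; rewrite !inE ?(negPf s_F') ?andbF //.
  case/andP=> u_v uF' uw; rewrite (upF' u w) // andbT.
  apply: contraNneq vF => w_v; rewrite w_v in uw.
  have /v_min : u < v by rewrite lt_neqAle u_v.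
  by rewrite inE uF' andbT negbK => /upF; apply.
apply: (connect_trans (IHn _ F'vP _ _)).
- by rewrite D_v; move: le_n; rewrite (cardsD1 v) vD.
- by rewrite subsetD1 FF'.
apply/connect1/existsP; exists v.
have v_nin : v \notin F' :\ v by rewrite !inE eqxx.
rewrite can_fire_fired_orientation // fire_fired_orientation // setD1K //.
by rewrite v_nin F'P /=.
Qed.

Lemma fired_set0 : fired_set set0.
Proof. by apply/fired_setP; split=> [|u v]; rewrite inE. Qed.

Definition comparability_game : edge_firing_game :=
  EdgeFiringGame comparability_sym comparability_irrefl comparability_connected
    s (fired_orientation_oriented set0).

Lemma comparability_game_simple : simple_game comparability_game.
Proof. by move=> vs /(firing_seq_fired_orientation fired_set0)[]. Qed.

Lemma connect_init_fired F : fired_set F ->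
  connect (fires_to s) (init comparability_game) (fired_orientation F).
Proof.
by move=> FP; rewrite connect_fired_orientation ?fired_set0 ?sub0set.
Qed.

Lemma comparability_game_configurationP
    (C : configuration_space comparability_game) :
  exists2 F, fired_set F & val C = fired_orientation F.
Proof.
have /connect_fires_toP[vs] := valP C.
case/(firing_seq_fired_orientation fired_set0)=> FP _ _ eqC <-.
by exists (set0 :|: [set:: vs]).
Qed.

End ComparabilityGame.

(** * Birkhoff duality with the bottom element added to the primes *)

Section Birkhoff.

Variables (d : Order.disp_t) (L : finTBDistrLatticeType d).
Implicit Types (x y : L).

Definition join_prime : pred L :=
  [pred j | [forall x, forall y,
     (j <= x `|` y) ==> ((j <= x) || (j <= y))]].

Lemma join_primeP j :
  reflect (forall x y, j <= x `|` y -> (j <= x) || (j <= y)) (join_prime j).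
Proof.
apply: (iffP forallP) => [prime_j x y | prime_j x].
  by have /forallP/(_ y)/implyP := prime_j x.
by apply/forallP=> y; apply/implyP/prime_j.
Qed.

Lemma join_prime_bot : join_prime \bot.
Proof. by apply/join_primeP=> x y; rewrite !le0x. Qed.

(** A minimal [j] below [x] but not below [y] is prime: if [j] is below the join of [a] and [b] but
    below neither, its meets with both are strictly smaller, hence below [y], and by distributivity
    so is their join [j]. *)
Lemma join_prime_separation x y :
  ~~ (x <= y) -> exists2 j, join_prime j & (j <= x) && ~~ (j <= y).
Proof.
move=> xy; have Px : [pred z | (z <= x) && ~~ (z <= y)] x by rewrite /= lexx.
have [j /= /andP[jx jy] j_min] := exists_minimal Px.
exists j; last by rewrite jx.
apply/join_primeP=> a b jab; apply: contraNT jy.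
have below c : ~~ (j <= c) -> j `&` c <= y.
  move=> jc; have /j_min : j `&` c < j by rewrite lt_leAnge leIl lexI lexx.
  by rewrite inE (le_trans (leIl j c) jx) negbK.
rewrite negb_or => /andP[/below ja /below jb].
by rewrite -(meet_idPl jab) meetUr leUx ja.
Qed.

Definition join_primes := {j : L | join_prime j}.

HB.instance Definition _ := SubFinite.on join_primes.
HB.instance Definition _ :=
  [SubChoice_isSubPOrder of join_primes by <: with d].

Definition join_prime0 : join_primes := Sub \bot join_prime_bot.

Lemma join_prime0_min (j : join_primes) : join_prime0 <= j.
Proof. exact: le0x. Qed.

Definition not_below x : {set join_primes} :=
  [set j : join_primes | ~~ (val j <= x)].

Lemma fired_set_not_below x : fired_set join_prime0 (not_below x).
Proof.
apply/fired_setP; split=> [|i j]; first by rewrite inE negbK le0x.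
by rewrite !inE => i_x ij; apply: contra i_x; apply: le_trans.
Qed.

Lemma not_below_subset x y : (not_below y \subset not_below x) = (x <= y).
Proof.
apply/subsetP/idP => [sub | xy j].
  apply/negPn/negP=> /join_prime_separation[j jP /andP[jx jy]].
  by have := sub (Sub j jP); rewrite !inE /= jy jx => /(_ isT).
by rewrite !inE; apply: contra => jx; apply: le_trans xy.
Qed.

Lemma joins_not_belowK (F : {set join_primes}) :
  fired_set join_prime0 F -> not_below (\join_(j in ~: F) val j) = F.
Proof.
case/fired_setP=> F0 upF; apply/setP=> j; rewrite inE.
apply/idP/idP => [|jF].
  by apply: contraNT => jF; apply: joins_sup; rewrite inE.
have /join_primeP prime_j := valP j.
elim/big_rec: _ => [|i x iF].
  (* Empty join: [\bot] is itself a vertex here, and is ruled out only because the sink is not in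
     [F]. *)
  rewrite lex0; apply: contra F0 => /eqP j0.
  by apply: upF jF _; rewrite leEsub /= j0.
apply: contraNN => /prime_j/orP[ji|//].
by rewrite inE (upF j i) in iF.
Qed.

End Birkhoff.

Theorem theorem2 (d : Order.disp_t) (L : finTBDistrLatticeType d) :
  exists G : edge_firing_game,
    simple_game G /\
    exists f : L -> configuration_space G,
      bijective f /\
      forall x y : L, (x <= y)%O = configuration_le (f x) (f y).
Proof.
pose s_min := @join_prime0_min d L.
exists (comparability_game s_min).
split; first exact: comparability_game_simple.
pose f x : configuration_space (comparability_game s_min) :=
  Sub (fired_orientation (not_below x))
      (connect_init_fired s_min (fired_set_not_below x)).
(* Two reversals cancel: a larger [x] has a smaller [not_below x], and fewer firings give a larger
   configuration. *)
have f_mono x y : (x <= y) = configuration_le (f x) (f y).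
  rewrite /configuration_le connect_fired_orientation ?not_below_subset //;
  exact: fired_set_not_below.
exists f; split=> //.
have f_inj : injective f.
  move=> x y fxy; apply/le_anti.
  by rewrite !f_mono fxy /configuration_le connect0.
(* Join of the unfired vertices, recognised by having no arc into the sink. The sink itself is among
   them and contributes only [\bot]. *)
pose g (C : configuration_space (comparability_game s_min)) :=
  \join_(j | (j, join_prime0 L) \notin val C) val j.
have fK : cancel g f.
  move=> C; apply: val_inj.
  have [F FP eqC] := comparability_game_configurationP C.
  have [sF _] := fired_setP _ _ FP.
  have gC : g C = \join_(j in ~: F) val j.
    by apply: eq_bigl => j; rewrite eqC mem_fired_orientation_min // inE.
  by rewrite eqC /= gC joins_not_belowK.
by exists g => //; apply: inj_can_sym fK f_inj.
Qed.
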